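(* The matching $M$ on $\Gamma(m,n)$ defined below is an acyclic partial matching on its Hasse diagram: there is no sequence of distinct elements $T_1,\dots,T_r$, $r\ge2$, with $T_1\lessdot u(T_1)\gtrdot T_2\lessdot u(T_2)\gtrdot\cdots\gtrdot T_r\lessdot u(T_r)\gtrdot T_1$.
   Context: The staircase board of length $m$ consists of squares $(i,j)$, $i,j\ge1$, $i+j\le m$ (row $i$ from top, column $j$ from left); square $(i,j)$ is shaded if $m-i-j$ (the number of squares below it in its column) is even. $\mathcal R(m,n)$ is the set of placements of $n$ rooks with no two in the same column. $\Gamma(m,n)$ is the poset on $\mathcal R(m,n)$ generated by covers $T\lessdot T'$ when $T'\in\mathcal R(m,n)$ arises from $T$ by moving one rook one square up or one square left. The matching: for $T$, let $r$ be the leftmost rook of $T$ that is not on a shaded square of row $1$. If $r$ is on an unshaded square, match $T$ with the placement obtained by moving $r$ down one square (then $T=u(\cdot)$ of that placement); if $r$ is on a shaded square not in row $1$, match $T$ with $u(T)$, obtained by moving $r$ up one square. Placements with all rooks on shaded squares of row $1$ are unmatched. *)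

(* Defs.v *)
From HB Require Import structures.
From mathcomp Require Import all_boot all_order.

Set Implicit Arguments.
Unset Strict Implicit.
Unset Printing Implicit Defensive.

Import Order.TTheory.

(* A square (i, j), in row i from the top and column j from the left, is      *)
(* numbered from 1. As i, j >= 1 and i + j <= m force i, j < m, the values of *)
(* 'I_m (which also include 0) suffice; the board excludes the value 0.       *)
Notation square m := ('I_m * 'I_m)%type.

Definition board (m : nat) : {set square m} :=
  [set s : square m | [&& 0 < s.1, 0 < s.2 & s.1 + s.2 <= m]].

(* On the board the subtractions are not truncated. *)
Definition shaded (m : nat) (s : square m) : bool := ~~ odd (m - s.1 - s.2).

Definition one_up (m : nat) (s t : square m) : bool :=
  (s.1 == t.1.+1 :> nat) && (s.2 == t.2).

Definition one_left (m : nat) (s t : square m) : bool :=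
  (s.1 == t.1) && (s.2 == t.2.+1 :> nat).

Definition is_placement (m n : nat) (T : {set square m}) : bool :=
  [&& T \subset board m, #|T| == n
    & [forall s in T, forall t in T, (s.2 == t.2) ==> (s == t)]].

Record placement (m n : nat) := Placement {
  rooks :> {set square m};
  _ : is_placement n rooks }.

HB.instance Definition _ (m n : nat) := [isSub for @rooks m n].
HB.instance Definition _ (m n : nat) := [Finite of placement m n by <:].

Definition replace_rook (m : nat) (T : {set square m}) (s t : square m) :
  {set square m} := t |: T :\ s.

(* T' has n rooks too, so t cannot be a square already occupied in T.         *)
Definition elem_move (m n : nat) : rel (placement m n) := fun T T' =>
  [exists s : square m, exists t : square m,
    [&& s \in rooks T, one_up s t || one_left s t
      & rooks T' == replace_rook T s t]].

Definition placement_le (m n : nat) : rel (placement m n) :=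
  connect (@elem_move m n).

Section PlacementOrder.
Variables m n : nat.
Implicit Types T : placement m n.

Let rank T := \sum_(s in rooks T) (s.1 + s.2).

Lemma elem_move_rank T T' : elem_move T T' -> rank T = (rank T').+1.
Proof.
case/existsP=> s /existsP[t /and3P[sT st /eqP eT']].
have cT : #|rooks T| = n by case: (T) => A /= /and3P[_ /eqP].
have cT' : #|rooks T'| = n by case: (T') => A /= /and3P[_ /eqP].
have tN : t \notin rooks T :\ s.
  have : #|rooks T'| = #|rooks T| by rewrite cT cT'.
  rewrite eT' cardsU1 (cardsD1 s (rooks T)) sT => /eqP.
  by rewrite eqn_add2r; case: (t \notin _).
rewrite /rank eT' (big_setD1 s sT) /= (big_setU1 _ tN) /= -addSn.
congr (_ + _); case/orP: st => /andP[/eqP e1 /eqP e2].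
  by rewrite e1 e2 addSn.
by rewrite e1 e2 addnS.
Qed.

Lemma placement_le_rank T T' :
  placement_le T T' -> rank T' <= rank T ?= iff (T == T').
Proof.
case/connectP=> p; elim: p T => [|A p IHp] T /=.
  by move=> _ ->; rewrite eqxx; split; rewrite ?leqnn ?eqxx.
case/andP=> /elem_move_rank rT pA eT'.
have lt : rank T' < rank T by rewrite rT ltnS; exact: (IHp A pA eT').1.
split; first exact: ltnW.
by rewrite (ltn_eqF lt); case: eqP lt => // ->; rewrite ltnn.
Qed.

Lemma placement_le_refl : reflexive (@placement_le m n).
Proof. by move=> T; exact: connect0. Qed.

Lemma placement_le_anti : antisymmetric (@placement_le m n).
Proof.
move=> T T' /andP[/placement_le_rank[le1 eq1] /placement_le_rank[le2 _]].
by apply/eqP; rewrite -eq1 eqn_leq le1 le2.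
Qed.

Lemma placement_le_trans : transitive (@placement_le m n).
Proof. by move=> y x z; exact: connect_trans. Qed.

End PlacementOrder.

Fact placement_display : Order.disp_t. Proof. exact: Order.Disp tt tt. Qed.

HB.instance Definition _ (m n : nat) :=
  Order.Le_isPOrder.Build placement_display (placement m n)
    (@placement_le_refl m n) (@placement_le_anti m n) (@placement_le_trans m n).

Definition Gamma (m n : nat) : finPOrderType placement_display :=
  placement m n.

Section PosetMatching.
Variables (d : Order.disp_t) (P : finPOrderType d).

Definition covered_by (x y : P) : bool :=
  (x < y)%O && [forall z : P, ~~ (x < z < y)%O].

(* A set of pairs is given as a relation M, the pair (x, y) being oriented so *)
(* that x is the lower element; thus M x y reads "y = u(x)".                  *)
Definition partial_matching (M : rel P) : Prop :=
  (forall x y, M x y -> covered_by x y) /\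
  (forall x y x' y', M x y -> M x' y' ->
     forall z, z \in [:: x; y] -> z \in [:: x'; y'] -> (x, y) = (x', y')).

Definition matching_step (M : rel P) : rel P := fun x x' =>
  [exists y : P, [&& M x y, covered_by x y & covered_by x' y]].

Definition acyclic_matching (M : rel P) : Prop :=
  ~ exists s : seq P, 2 <= size s /\ ucycle (matching_step M) s.

End PosetMatching.

Definition row1_shaded (m : nat) (s : square m) : bool :=
  (s.1 == 1 :> nat) && shaded s.

Definition leftmost_free_rook (m n : nat) (T : placement m n) (r : square m) :
  bool :=
  [&& r \in rooks T, ~~ row1_shaded r
    & [forall s in rooks T, ~~ row1_shaded s ==> (r.2 <= s.2)]].

(* First disjunct: T' is the partner that the matching rule prescribes to T,  *)
(* one rook of T moving up. Second: T is the partner prescribed to T', one    *)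
(* rook of T' moving down.                                                    *)
Definition staircase_matching (m n : nat) : rel (Gamma m n) := fun T T' =>
  [exists r : square m, exists t : square m,
    [&& leftmost_free_rook T r, shaded r, r.1 != 1 :> nat, one_up r t
      & rooks T' == replace_rook T r t]]
  || [exists r : square m, exists t : square m,
    [&& leftmost_free_rook T' r, ~~ shaded r, one_up t r
      & rooks T == replace_rook T' r t]].

(* Main.v *)
Require Import Defs.
From mathcomp Require Import all_boot all_order.

(** If [T] and [T'] are matched, the rook that moves is the leftmost free rook
    of both, on a shaded square in [T] and on an unshaded one in [T'].  Take a
    step [T < u(T) > T2] with [T2] itself a lower element of the matching.  If
    [T2 < u(T)] is a move up, comparing the leftmost free rooks of [T2] and
    [u(T)] forces [T2 = T].  Otherwise it is a move left, and the sum of the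
    column indices of the rooks, which matched pairs share, is larger by one in
    [T2] than in [T].  This sum thus increases strictly along the steps, which
    rules out a cycle. *)

Set Implicit Arguments.
Unset Strict Implicit.
Unset Printing Implicit Defensive.

Import Order.TTheory.

(** * Rook placements and the replacement of one rook *)

Lemma placement_board m n (T : placement m n) s :
  s \in rooks T -> s \in board m.
Proof. by case: T => A /= /and3P[/subsetP sAB _ _]; exact: sAB. Qed.

Lemma placement_card m n (T : placement m n) : #|rooks T| = n.
Proof. by case: T => A /= /and3P[_ /eqP]. Qed.

Lemma placement_column m n (T : placement m n) s t :
  s \in rooks T -> t \in rooks T -> s.2 = t.2 -> s = t.
Proof.
case: T => A /= /and3P[_ _ /forall_inP colA] sA tA st.
by move/forall_inP: (colA s sA) => /(_ t tA); rewrite st eqxx /= => /eqP.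
Qed.

Lemma in_replace_rook m (T : {set square m}) s t x :
  (x \in replace_rook T s t) = (x == t) || (x != s) && (x \in T).
Proof. by rewrite !inE. Qed.

Section ReplaceRook.
Variables (m n : nat) (T T' : placement m n) (s t : square m).
Hypotheses (sT : s \in rooks T) (defT' : rooks T' = replace_rook T s t).

(** Landing on an occupied square would lose a rook, but both placements have [n]. *)
Lemma replace_rook_notin : t \notin rooks T :\ s.
Proof.
have : #|rooks T'| = #|rooks T| by rewrite !placement_card.
rewrite defT' cardsU1 (cardsD1 s (rooks T)) sT => /eqP.
by rewrite eqn_add2r; case: (t \notin _).
Qed.

Lemma replace_rookK : rooks T = replace_rook T' t s.
Proof. by rewrite defT' /replace_rook setU1K ?setD1K // replace_rook_notin. Qed.

Lemma sum_replace_rook (F : square m -> nat) :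
  \sum_(x in rooks T) F x + F t = \sum_(x in rooks T') F x + F s.
Proof.
rewrite defT' (big_setD1 s sT) (big_setU1 _ replace_rook_notin) /=.
by rewrite addnAC addnC addnA addnC addnA.
Qed.

End ReplaceRook.

(** On the board the subtractions are not truncated, so going up changes the parity. *)
Lemma shaded_one_up m (s t : square m) :
  s \in board m -> one_up s t -> shaded t = ~~ shaded s.
Proof.
rewrite inE => /and3P[_ _ les] /andP[/eqP s1 /eqP s2].
rewrite /shaded -!subnDA -s2.
have -> : m - (t.1 + s.2) = (m - (s.1 + s.2)).+1.
  by rewrite -subSn // s1 addSn subSS.
by [].
Qed.

Lemma unshaded_free m (s : square m) : ~~ shaded s -> ~~ row1_shaded s.
Proof. by rewrite /row1_shaded negb_and orbC => ->. Qed.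

(** * Covers of [Gamma] are exactly the elementary moves *)

Section Covers.
Variables m n : nat.
Implicit Types T : Gamma m n.

Lemma elem_move_lt T T' : elem_move T T' -> (T < T')%O.
Proof.
move=> mv; rewrite lt_neqAle; apply/andP; split; last exact: connect1.
apply/eqP=> eqT; move/elem_move_rank: mv => /=.
by rewrite eqT => /eqP; rewrite ltn_eqF.
Qed.

Lemma placement_lt_rank T T' :
    (T < T')%O ->
  \sum_(s in rooks T') (s.1 + s.2) < \sum_(s in rooks T) (s.1 + s.2).
Proof.
rewrite lt_neqAle => /andP[neT /placement_le_rank[/= leT eqT]].
by rewrite ltn_neqAle leT eqT neT.
Qed.

(** A move lowers the sum of all coordinates by exactly one, which leaves no room in between.
    Conversely, a path of moves realizing a cover must reach its end with the first move. *)
Lemma elem_move_covered_by T T' : elem_move T T' = covered_by T T'.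
Proof.
apply/idP/andP=> [mv | [ltT /forallP cov]].
  split; first exact: elem_move_lt.
  apply/forallP=> A; apply/negP=> /andP[/placement_lt_rank + /placement_lt_rank].
  rewrite (elem_move_rank mv) ltnS => leA /leq_trans/(_ leA).
  by rewrite ltnn.
have /connectP[[|A p] /=] : placement_le T T' by exact: ltW.
  by move=> _ eT; rewrite eT ltxx in ltT.
case/andP=> mvA pA eT'; have leA : (A <= T')%O by apply/connectP; exists p.
have := cov A; rewrite (elem_move_lt mvA) /= lt_neqAle leA andbT negbK.
by move/eqP <-.
Qed.

End Covers.

(** * The matching rule and its consistency *)

Section StaircaseMatching.
Variables m n : nat.
Implicit Types (T A B : Gamma m n) (r s t : square m).

Lemma leftmost_free_rook_uniq T r s :
  leftmost_free_rook T r -> leftmost_free_rook T s -> r = s.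
Proof.
case/and3P=> rT fr /forall_inP minr /and3P[sT fs /forall_inP mins].
apply: (placement_column rT sT); apply/val_inj/eqP.
by rewrite eqn_leq (implyP (minr s sT)) // (implyP (mins r rT)).
Qed.

Lemma leftmost_free_rook_replace A B r t :
    leftmost_free_rook A r -> rooks B = replace_rook A r t -> r.2 = t.2 ->
    ~~ row1_shaded t ->
  leftmost_free_rook B t.
Proof.
case/and3P=> rA _ /forall_inP minr defB rt ft.
rewrite /leftmost_free_rook ft defB in_replace_rook eqxx /=.
apply/forall_inP=> s; rewrite in_replace_rook -rt => /orP[/eqP-> | /andP[_ sA]].
  by rewrite rt leqnn implybT.
exact: minr.
Qed.

(** Both disjuncts of the matching rule yield these same symmetric data. *)
Variant matched_spec A B : Prop :=
  MatchedSpec r t of leftmost_free_rook A r & leftmost_free_rook B t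
    & shaded r & ~~ shaded t & one_up r t
    & rooks B = replace_rook A r t & rooks A = replace_rook B t r.

Lemma staircase_matchingP A B : staircase_matching A B -> matched_spec A B.
Proof.
case/orP=> /existsP[r /existsP[t]].
  case/and5P=> lr sr _ up /eqP defB; have rA : r \in rooks A by case/and3P: lr.
  have st : ~~ shaded t.
    by rewrite (shaded_one_up (placement_board rA) up) sr.
  exists r t => //; last exact: replace_rookK.
  have /andP[_ /eqP rt] := up.
  exact: leftmost_free_rook_replace lr defB rt (unshaded_free st).
case/and4P=> lr sr up /eqP defA; have rB : r \in rooks B by case/and3P: lr.
have tA : t \in rooks A by rewrite defA in_replace_rook eqxx.
have st : shaded t.
  by move: sr; rewrite (shaded_one_up (placement_board tA) up) negbK.
exists t r => //; last exact: replace_rookK.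
have /andP[/eqP t1 /eqP tr] := up.
apply: leftmost_free_rook_replace lr defA (esym tr) _.
(* Since [t] lies below a square of the board, it is not in row 1. *)
have := placement_board rB; rewrite inE /row1_shaded t1 => /and3P[r1 _ _].
by rewrite eqSS eqn0Ngt r1.
Qed.

Lemma one_up_inj r s t : one_up r t -> one_up s t -> r = s.
Proof.
case: r s t => [r1 r2] [s1 s2] [t1 t2].
case/andP=> /= /eqP er /eqP-> /andP[/= /eqP es /eqP->].
by congr (_, _); apply: val_inj; rewrite /= er es.
Qed.

Lemma one_up_fun r s t : one_up r s -> one_up r t -> s = t.
Proof.
case: r s t => [r1 r2] [s1 s2] [t1 t2].
case/andP=> /= /eqP er /eqP <- /andP[/= /eqP es /eqP <-].
by congr (_, _); apply: val_inj; case: (etrans (esym er) es).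
Qed.

(** The shade of the unique leftmost free rook tells whether a placement is a lower or an upper
    element, and a vertical move is determined by either of its ends. *)
Lemma staircase_partial_matching : partial_matching (@staircase_matching m n).
Proof.
split=> [A B /staircase_matchingP[r t lr _ _ _ up defB _] | A B A' B'].
  rewrite -elem_move_covered_by; apply/existsP; exists r; apply/existsP.
  by exists t; case/and3P: lr => -> _ _; rewrite up defB eqxx.
case/staircase_matchingP=> r t lr lt sr st up defB defA.
case/staircase_matchingP=> r' t' lr' lt' sr' st' up' defB' defA'.
move=> T; rewrite !inE => /orP[]/eqP-> /orP[]/eqP eqT.
- move: lr' up' defB'; rewrite -{}eqT => /(leftmost_free_rook_uniq lr) <-.
  move=> /(one_up_fun up) <- defB'.
  by congr (_, _); apply: val_inj; rewrite /= defB defB'.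
- by move: lt' st'; rewrite -eqT => /(leftmost_free_rook_uniq lr) <-; rewrite sr.
- by move: lt st; rewrite eqT => /(leftmost_free_rook_uniq lr') <-; rewrite sr'.
move: lt' up' defA'; rewrite -{}eqT => /(leftmost_free_rook_uniq lt) <-.
move=> /(one_up_inj up) <- defA'.
by congr (_, _); apply: val_inj; rewrite /= defA defA'.
Qed.

(** * Acyclicity through the column sum *)

Definition column_sum T := \sum_(s in rooks T) s.2.

Lemma column_sum_one_up A B s t :
    s \in rooks A -> one_up s t -> rooks B = replace_rook A s t ->
  column_sum A = column_sum B.
Proof.
move=> sA /andP[_ /eqP st] defB; apply/eqP.
have := sum_replace_rook sA defB (fun x : square m => x.2).
by rewrite st => /eqP; rewrite eqn_add2r.
Qed.

Lemma column_sum_one_left A B s t :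
    s \in rooks A -> one_left s t -> rooks B = replace_rook A s t ->
  column_sum A = (column_sum B).+1.
Proof.
move=> sA /andP[_ /eqP st] defB; apply/eqP.
have := sum_replace_rook sA defB (fun x : square m => x.2).
by rewrite st addnS -addSn => /eqP; rewrite eqn_add2r.
Qed.

Lemma one_up_to_partner A B A' B' s t :
    staircase_matching A B -> staircase_matching A' B' ->
    s \in rooks A' -> one_up s t -> rooks B = replace_rook A' s t ->
  A = A'.
Proof.
case/staircase_matchingP=> r q _ lq sr sq up _ defA.
case/staircase_matchingP=> r' _ lr' _ sr' _ _ _ _ sA' ups defB.
have defA' : rooks A' = replace_rook B t s by exact: replace_rookK.
(* If [t] is the leftmost free rook [q] of [B], moving it back down gives both [A] and [A']. The
   other case is contradictory. *)
have [eqt | neqt] := eqVneq t q.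
  apply: val_inj; rewrite /= defA defA' eqt (one_up_inj (r := r) (s := s) (t := q)) //.
  by rewrite -eqt.
have /and3P[qB fq /forall_inP minq] := lq.
have /and3P[rA' fr' /forall_inP minr'] := lr'.
have tB : t \in rooks B by rewrite defB in_replace_rook eqxx.
have qA' : q \in rooks A'.
  by rewrite defA' in_replace_rook (eq_sym q t) neqt qB orbT.
have ler'q : r'.2 <= q.2 := implyP (minr' q qA') fq.
(* If [r'] is the rook that moves, it becomes a free rook [t] of [B] and minimality on both sides
   puts [t] in the column of [q]. If it stays, the same comparison gives [r' = q], against their
   shades. *)
have [eqs | neqs] := eqVneq r' s.
  have st : ~~ shaded t.
    by rewrite (shaded_one_up (placement_board sA') ups) -eqs sr'.
  have leqt : q.2 <= t.2 := implyP (minq t tB) (unshaded_free st).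
  have /andP[_ /eqP st2] := ups; case/eqP: neqt.
  apply: (placement_column tB qB); apply/val_inj/eqP.
  by rewrite eqn_leq leqt -st2 -eqs ler'q.
have r'B : r' \in rooks B by rewrite defB in_replace_rook neqs rA' orbT.
have leqr' : q.2 <= r'.2 := implyP (minq r' r'B) fr'.
have eqr : r' = q.
  by apply: (placement_column rA' qA'); apply/val_inj/eqP; rewrite eqn_leq ler'q.
by rewrite -eqr sr' in sq.
Qed.

Lemma matching_step_column_sum A A' :
    matching_step (@staircase_matching m n) A A' ->
  column_sum A <= column_sum A' /\
  forall B', staircase_matching A' B' -> A != A' ->
    column_sum A < column_sum A'.
Proof.
case/existsP=> B /and3P[mAB _]; rewrite -elem_move_covered_by.
case/existsP=> s /existsP[t /and3P[sA' st /eqP defB]].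
have -> : column_sum A = column_sum B.
  have [r q /and3P[rA _ _] _ _ _ up eqB _] := staircase_matchingP mAB.
  exact: column_sum_one_up rA up eqB.
case/orP: st => st; last by rewrite (column_sum_one_left sA' st defB).
rewrite (column_sum_one_up sA' st defB); split=> // B' mAB'.
by rewrite (one_up_to_partner mAB mAB' sA' st defB) eqxx.
Qed.

Lemma staircase_acyclic_matching : acyclic_matching (@staircase_matching m n).
Proof.
case=> [[|A [|A' p]] [] // _ /andP[/= /andP[stepA pA'] /andP[]]].
rewrite inE negb_or => /andP[neqA _] _.
(* [A'] is the source of the next step of the cycle, hence a lower element. *)
have [B' mA'] : exists B', staircase_matching A' B'.
  by case: p pA' => [|A'' p] /= /andP[/existsP[B' /and3P[mA' _ _]] _]; exists B'.
have ltA := (matching_step_column_sum stepA).2 B' mA' neqA.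
(* One strict step is enough: the way back to [A] needs only the weak inequality. *)
suff leA : column_sum A' <= column_sum A.
  by have := leq_trans ltA leA; rewrite ltnn.
rewrite -[in leqRHS](last_rcons A' p A).
elim: (rcons p A) (A') pA' => //= C q IHq D /andP[/matching_step_column_sum[leD _]].
by move/IHq; exact: leq_trans.
Qed.

End StaircaseMatching.

Theorem theorem8p3 (m n : nat) :
  partial_matching (@staircase_matching m n) /\
  acyclic_matching (@staircase_matching m n).
Proof.
split; [exact: staircase_partial_matching | exact: staircase_acyclic_matching].
Qed.
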